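(* Let $n \geq 1$ and $m \geq n$, and let $X = \mathrm{Spec}\,\mathbb{C}[x,y,z]/\langle xy - z^{n+1}\rangle$. Let $\Gamma = (V,E)$ be the graph whose vertices are the irreducible components $Z_m^1,\ldots,Z_m^n$ of the singular fiber $X_m^0$, and whose edge set $E$ is the set of maximal elements, for the inclusion relation, of $\{Z_m^i \cap Z_m^j \mid i \neq j\}$, where there is an edge between $Z_m^i$ and $Z_m^j$ ($i\ne j$) if and only if $Z_m^i \cap Z_m^j \in E$. Then $\Gamma$ is isomorphic to the resolution graph of an $A_n$-type singularity.
   Context: Let $f = xy - z^{n+1}$. For $m \geq 0$ let $R_m = \mathbb{C}[x_0,\ldots,x_m,y_0,\ldots,y_m,z_0,\ldots,z_m]$, and define $f^{(0)},\ldots,f^{(m)} \in R_m$ by $f(\sum_{k=0}^m x_kt^k, \sum_{k=0}^m y_kt^k, \sum_{k=0}^m z_kt^k) \equiv \sum_{k=0}^m f^{(k)}t^k \pmod{t^{m+1}}$. The $m$-th jet scheme of $X$ is $X_m = \mathrm{Spec}\,R_m/\langle f^{(0)},\ldots,f^{(m)}\rangle \subseteq \mathbb{A}^{3(m+1)}$, with truncation morphism $\pi_m : X_m \to X$, and the singular fiber is $X_m^0 = \pi_m^{-1}(0)$, the fiber over the origin. For $m \geq n$ its irreducible components are (Mourtada) $Z_m^l = \mathbf{V}(I_m^l)$ for $1 \leq l \leq n$, where $I_m^l = \langle x_0,\ldots,x_{l-1},y_0,\ldots,y_{n-l},z_0,f^{(0)},\ldots,f^{(m)}\rangle \subseteq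 R_m$. Intersections are taken set-theoretically (as reduced closed subvarieties). The resolution graph of a rational double point is the dual graph of the exceptional curves of its minimal resolution; for type $A_n$ it is the Dynkin diagram $A_n$, i.e. a path with $n$ vertices. *)

(* Defs.v *)
From HB Require Import structures.
From mathcomp Require Import all_boot all_order all_algebra.
From mathcomp Require Import boolp classical_sets reals.
From mathcomp Require Import complex.
From mathcomp Require Import mpoly.

Set Implicit Arguments.
Unset Strict Implicit.
Unset Printing Implicit Defensive.

Import GRing.Theory.
Local Open Scope classical_set_scope.
Local Open Scope ring_scope.

Section AffineGeometry.
Variables (K : fieldType) (N : nat).

Definition is_ideal (A : comNzRingType) (I : set A) : Prop :=
  [/\ I 0, (forall a b, I a -> I b -> I (a + b)) & (forall c a, I a -> I (c * a))].

Definition ideal_span (A : comNzRingType) (G : set A) : set A :=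
  smallest (@is_ideal A) G.

Definition affine_space : Type := 'I_N -> K.

(* Closed subvarieties are represented by their K-points. As K will be the
   field of complex numbers, reduced closed subvarieties of affine space and
   their sets of K-points determine each other (Nullstellensatz), compatibly
   with inclusion and with set-theoretic intersection. *)
Definition zero_locus (I : set {mpoly K[N]}) : set affine_space :=
  [set p | forall g, I g -> g.@[p] = 0].

Definition zariski_closed (A : set affine_space) : Prop :=
  exists I : set {mpoly K[N]}, A = zero_locus I.

Definition zariski_irreducible (Z : set affine_space) : Prop :=
  Z !=set0 /\
  forall A B, zariski_closed A -> zariski_closed B ->
    Z `<=` A `|` B -> Z `<=` A \/ Z `<=` B.

Definition irreducible_components (Y : set affine_space) :
    set (set affine_space) :=
  [set Z | [/\ zariski_irreducible Z, Z `<=` Y &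
     forall W, zariski_irreducible W -> W `<=` Y -> Z `<=` W -> W = Z]].

End AffineGeometry.

(* The polynomial f = x y - z^(n+1), evaluated in any commutative ring. *)
Definition fA (n : nat) (A : comNzRingType) (x y z : A) : A :=
  x * y - z ^+ n.+1.

Section JetScheme.
Variables (K : fieldType) (n m : nat).

(* Ambient coordinates, in this order: x_0..x_m, y_0..y_m, z_0..z_m. *)
Definition jet_dim : nat := (m.+1 + m.+1 + m.+1)%N.
Definition ix (k : 'I_m.+1) : 'I_jet_dim := lshift m.+1 (lshift m.+1 k).
Definition iy (k : 'I_m.+1) : 'I_jet_dim := lshift m.+1 (rshift m.+1 k).
Definition iz (k : 'I_m.+1) : 'I_jet_dim := rshift (m.+1 + m.+1) k.

Definition jet_ring := {mpoly K[jet_dim]}.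
Definition jet_space := affine_space K jet_dim.

Definition jet_x (k : 'I_m.+1) : jet_ring := 'X_(ix k).
Definition jet_y (k : 'I_m.+1) : jet_ring := 'X_(iy k).
Definition jet_z (k : 'I_m.+1) : jet_ring := 'X_(iz k).

(* The generic arc sum_(k <= m) c_k t^k, as a polynomial in t over R_m. *)
Definition generic_arc (c : 'I_m.+1 -> jet_ring) : {poly jet_ring} :=
  \sum_(k < m.+1) (c k)%:P * 'X^k.

Definition jet_f (k : 'I_m.+1) : jet_ring :=
  (fA n (generic_arc jet_x) (generic_arc jet_y) (generic_arc jet_z))`_k.

Definition jet_scheme : set jet_space :=
  zero_locus (ideal_span (range jet_f)).

Definition truncation (p : jet_space) : K * K * K :=
  (p (ix ord0), p (iy ord0), p (iz ord0)).

Definition singular_fiber : set jet_space :=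
  jet_scheme `&` truncation @^-1` [set (0, 0, 0)].

Definition I_ideal (l : nat) : set jet_ring :=
  ideal_span
    (jet_x @` [set k : 'I_m.+1 | (k < l)%N] `|` jet_y @` [set k : 'I_m.+1 | (k <= n - l)%N]
     `|` [set jet_z ord0] `|` range jet_f).

Definition Z_comp (l : nat) : set jet_space := zero_locus (I_ideal l).

End JetScheme.

Arguments jet_scheme : clear implicits.
Arguments singular_fiber : clear implicits.
Arguments I_ideal : clear implicits.
Arguments Z_comp : clear implicits.

Record simple_graph := SimpleGraph {
  vertex :> Type;
  edge : vertex -> vertex -> Prop;
  edge_sym : forall u v, edge u v -> edge v u;
  edge_irrefl : forall u, ~ edge u u }.

Definition graph_isomorphic (G H : simple_graph) : Prop :=
  exists f : G -> H,
    bijective f /\ forall u v : G, edge u v <-> edge (f u) (f v).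

Definition maximal_elements (T : Type) (S : set (set T)) : set (set T) :=
  [set A | S A /\ forall B, S B -> A `<=` B -> B = A].

Section JetGraph.
Variables (K : fieldType) (n m : nat).

Definition jet_components : set (set (jet_space K m)) :=
  irreducible_components (singular_fiber K n m).

Definition component_intersections : set (set (jet_space K m)) :=
  [set A | exists Z W, [/\ jet_components Z, jet_components W, Z <> W
                         & A = Z `&` W]].

Definition jet_edge (u v : set_type jet_components) : Prop :=
  u <> v /\ maximal_elements component_intersections (\val u `&` \val v).

Lemma jet_edge_sym u v : jet_edge u v -> jet_edge v u.
Proof. by case=> uv; rewrite setIC => h; split=> // vu; apply: uv. Qed.

Lemma jet_edge_irrefl u : ~ jet_edge u u.
Proof. by case. Qed.

Definition jet_graph : simple_graph :=
  SimpleGraph jet_edge_sym jet_edge_irrefl.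

End JetGraph.

Arguments jet_components : clear implicits.
Arguments component_intersections : clear implicits.
Arguments jet_graph : clear implicits.

Section Dynkin.
Variable n : nat.

Definition path_edge (i j : 'I_n) : Prop := (i.+1 = j :> nat) \/ (j.+1 = i :> nat).

Lemma path_edge_sym i j : path_edge i j -> path_edge j i.
Proof. by case; [right | left]. Qed.

Lemma path_edge_irrefl i : ~ path_edge i i.
Proof. by case=> /eqP; rewrite gtn_eqF. Qed.

(* The dual graph of the exceptional curves of the minimal resolution of an
   A_n singularity is the Dynkin diagram A_n, i.e. the path on n vertices. *)
Definition resolution_graph_A : simple_graph :=
  SimpleGraph path_edge_sym path_edge_irrefl.

End Dynkin.

(* Main.v *)
Require Import Defs.
From mathcomp Require Import all_boot all_order all_algebra all_fingroup.
From mathcomp Require Import boolp classical_sets reals.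
From mathcomp Require Import complex mpoly ring.

Set Implicit Arguments.
Unset Strict Implicit.
Unset Printing Implicit Defensive.

Import GRing.Theory Num.Theory.
Local Open Scope classical_set_scope.
Local Open Scope ring_scope.

(** The proof works with jets written as triples of polynomials X, Y, Z in t,
whose coefficients up to t^m are the coordinates. In these terms
([Z_compP]) the l-th subvariety is a system of divisibilities, t^l | X,
t^(n-l+1) | Y and t | Z, together with the jet equation
t^(m+1) | XY - Z^(n+1).

The subvarieties cover the fiber: as t divides Z and m >= n, the equation
gives t^(n+1) | XY, so the orders of X and Y add up to at least n + 1
([singular_fiber_cover]). They are pairwise incomparable, as the arc
(t^l, t^(n-l+1), t) lies only on the l-th one. So they are the irreducible
components as soon as each of them is irreducible.

Irreducibility is the substantial point. Dividing X, Y, Z by t^l,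
t^(n-l+1), t turns the equation into t^N | XY - Z^(n+1) with N = m - n. Where
X is a unit, Y is determined modulo t^N by X and Z, and clearing
denominators gives a polynomial map from an affine space into the
subvariety that reaches all these points ([chart]). Two points of a chart are
joined by a line of parameters, so a product of two functions vanishes on the
image only if a factor does ([charts_meet]).

For N = 0 there is no equation and the chart is onto. For N > 0 it remains to
see that the points with X a unit are dense ([monic_jet_dense]). Let (X, Y,
Z) be a solution. The coefficients of X and Y beyond the relevant degree are
free, so X and Y may be taken monic of the same degree d. Replace Z by Z + s,
and let P_s be XY plus the terms of degree less than N of (Z + s)^(n+1) -
Z^(n+1). Then P_s is monic of degree 2d, it is congruent to (Z + s)^(n+1)
modulo t^N, and P_s(0) = (Z(0) + s)^(n+1) is nonzero for all but one s. Hence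
every splitting of P_s into two monic factors of degree d is a solution whose
first factor does not vanish at t = 0. At s = 0, one of the splittings is (X,
Y). That a function vanishing on all the splittings for almost all s also
vanishes on those at s = 0 is proved without any topology, from the symmetric
functions of the roots ([vanishing_on_roots_specializes]).

For the graph, if i < j then the intersection of the i-th and the j-th
component is given by t^j | X, t^(n-i+1) | Y, t | Z and the equation. Testing
on the jets (t^j, 0, 0) and (0, t^(n-i+1), 0) shows that inclusion of
intersections is reverse inclusion of the intervals [i, j]
([Z_compI_sub]). The maximal intersections are those of the intervals
[i, i + 1], which are the edges of a path. *)

(** * Symmetric functions of the roots *)

Lemma eq_mmap n (A B : nzRingType) (f1 f2 : A -> B) (h1 h2 : 'I_n -> B) :
  f1 =1 f2 -> h1 =1 h2 -> mmap f1 h1 =1 mmap f2 h2.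
Proof.
by move=> ef eh p; apply: eq_bigr => mu _; rewrite ef (mmap1_eq _ eh).
Qed.

Lemma rmorph_mmap n (A B C : comNzRingType) (f : {rmorphism A -> B})
    (phi : {rmorphism B -> C}) (h : 'I_n -> B) (p : {mpoly A[n]}) :
  phi (mmap f h p) = mmap (phi \o f) (phi \o h) p.
Proof.
rewrite /mmap rmorph_sum; apply: eq_bigr => mu _; rewrite rmorphM /=.
by congr (_ * _); rewrite rmorph_prod; apply: eq_bigr => i _; rewrite rmorphXn.
Qed.

Lemma mmap_msym n (A B : comNzRingType) (f : {rmorphism A -> B})
    (h : 'I_n -> B) (s : 'S_n) (p : {mpoly A[n]}) :
  mmap f h (msym s p) = mmap f (h \o s) p.
Proof.
rewrite /msym rmorph_mmap; apply: eq_mmap => [a|i] /=; first by rewrite mmapC.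
by rewrite mmapX mmap1U.
Qed.

Lemma mmap_mesym n (A B : comNzRingType) (f : {rmorphism A -> B})
    (h : 'I_n -> B) k :
  mmap f h (mesym n A k) = (mesym n B k).@[h].
Proof.
rewrite /mesym !rmorph_sum; apply: eq_bigr => H _; rewrite !rmorph_prod /=.
by apply: eq_bigr => i _; rewrite mmapX mmap1U mevalXU.
Qed.

(** The coefficients of a monic polynomial P over A are the elementary symmetric
functions of its roots. The element q is the same for all specializations phi
of A, and this uniformity is what allows one to let a parameter vary. *)
Lemma symmetric_of_roots (A : comNzRingType) (K : idomainType) n
    (S : {mpoly A[n]}) (P : {poly A}) :
  S \is symmetric ->
  exists q : A, forall (phi : {rmorphism A -> K}) (al : n.-tuple K),
    \prod_(a <- al) ('X - a%:P) = map_poly phi P ->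
    mmap phi (tnth al) S = phi q.
Proof.
move=> /sym_fundamental [t [<- _]].
exists t.@[fun i => (-1) ^+ i.+1 * P`_(n - i.+1)] => phi al rootP.
rewrite /comp_mpoly /meval !rmorph_mmap; apply: eq_mmap => [a|i] /=.
  by rewrite mmapC.
have li : (i.+1 < n.+1)%N by rewrite ltnS.
rewrite tnth_mktuple mmap_mesym rmorphM rmorphXn rmorphN1.
rewrite -coef_map -rootP (mroots_coeff al (Ordinal li)) /=.
by rewrite mulrA -exprMn mulrNN mulr1 expr1n mul1r.
Qed.

Lemma poly_eq0_cofinite (K : numFieldType) (q : {poly K}) (c : K) :
  (forall s, s != c -> q.[s] = 0) -> q = 0.
Proof.
move=> q0; apply/eqP.
have : (q * ('X - c%:P)) == 0.
  apply: contraT => nz.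
  pose rs := [seq i%:R : K | i <- iota 0 (size (q * ('X - c%:P)))].
  have := @max_poly_roots _ _ rs nz.
  rewrite size_map size_iota ltnn; apply.
    apply/allP => s _; rewrite /root hornerM hornerXsubC.
    by have [->|/q0 ->] := eqVneq s c; rewrite ?subrr ?mulr0 ?mul0r.
  by rewrite map_inj_uniq ?iota_uniq // => i j /eqP; rewrite eqr_nat => /eqP.
by rewrite mulf_eq0 polyXsubC_eq0 orbF.
Qed.

(** Continuity of roots in algebraic form. For a constant tau, the product over
all permutations of tau minus the permuted G is symmetric in the roots, so it
is a polynomial q in s. Where G vanishes on all orderings of the roots, q
equals tau^(n!), so q is constant. Taking for tau the value of G at a given
ordering of the roots of the specialization at s makes one factor vanish,
whence tau = 0. *)
Lemma vanishing_on_roots_specializes (K : numClosedFieldType) n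
    (P : {poly {poly K}}) (G : {mpoly {poly K}[n]}) (c : K) :
  P \is monic -> size P = n.+1 ->
  (forall s (al : n.-tuple K), s != c ->
     \prod_(a <- al) ('X - a%:P) = map_poly (horner_eval s) P ->
     mmap (horner_eval s) (tnth al) G = 0) ->
  forall s (al : n.-tuple K),
     \prod_(a <- al) ('X - a%:P) = map_poly (horner_eval s) P ->
     mmap (horner_eval s) (tnth al) G = 0.
Proof.
move=> monP szP G0 s al rootP; set tau := mmap _ _ G.
pose S := \prod_(sg : 'S_n) ((tau%:P)%:MP - msym sg G).
have symS : S \is symmetric.
  apply/issymP => sg; rewrite /S rmorph_prod /=.
  rewrite [RHS](reindex_inj (mulIg sg)) /=; apply: eq_bigr => sg' _.
  by rewrite msymMm rmorphB /= [msym sg _%:MP]mmapC.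
have SE s' (al' : n.-tuple K) : mmap (horner_eval s') (tnth al') S =
    \prod_(sg : 'S_n) (tau - mmap (horner_eval s') (tnth al' \o sg) G).
  rewrite /S rmorph_prod; apply: eq_bigr => sg _.
  by rewrite rmorphB /= mmapC mmap_msym /= horner_evalE hornerC.
have [q qE] := symmetric_of_roots K P symS.
have permE (al' : n.-tuple K) (sg : 'S_n) :
    \prod_(a <- [tuple tnth al' (sg i) | i < n]) ('X - a%:P) =
    \prod_(a <- al') ('X - a%:P) :> {poly K}.
  rewrite !big_tuple [RHS](reindex_inj (@perm_inj _ sg)) /=.
  by apply: eq_bigr => i _; rewrite tnth_mktuple.
pose N := #|{: 'S_n}|.
have q_const : q = (tau ^+ N)%:P.
  apply/eqP; rewrite -subr_eq0; apply/eqP; apply: (@poly_eq0_cofinite _ _ c).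
  move=> s' ns'; rewrite hornerD hornerN hornerC.
  have [r rE] := closed_field_poly_normal (map_poly (horner_eval s') P).
  rewrite (monicP _) ?monic_map // scale1r in rE.
  have szr : size r == n.
    rewrite -eqSS -szP -(size_prod_XsubC r id) -rE size_map_poly_id0 //.
    by rewrite (monicP monP) rmorph1 oner_neq0.
  have /esym := qE (horner_eval s') (Tuple szr) (esym rE).
  rewrite /= horner_evalE SE => ->; apply/eqP; rewrite subr_eq0; apply/eqP.
  rewrite -prodr_const; apply: eq_bigr => sg _.
  (* a permuted list of roots is again a list of roots, where G vanishes *)
  have := G0 s' [tuple tnth (Tuple szr) (sg i) | i < n] ns'.
  rewrite permE -rE => /(_ erefl) => G0'.
  rewrite (eq_mmap (f2 := horner_eval s')
    (h2 := tnth [tuple tnth (Tuple szr) (sg i) | i < n])) ?G0' ?subr0 //.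
  by move=> i /=; rewrite tnth_mktuple.
have := qE (horner_eval s) al rootP; rewrite SE q_const /= horner_evalE hornerC.
rewrite (bigD1 1%g) //= (eq_mmap (f2 := horner_eval s) (h2 := tnth al)) //.
  by rewrite subrr mul0r => /esym/eqP; rewrite expf_eq0 => /andP[_ /eqP].
by move=> i /=; rewrite perm1.
Qed.

(** * Jets as triples of polynomials *)

(** Coefficients beyond t^m are ignored, which leaves freedom in the choice of
the polynomials. The coefficient ring is arbitrary because families of jets
are jets over a polynomial ring. *)
Definition jet (A : nzRingType) m (X Y Z : {poly A})
    (i : 'I_(jet_dim m)) : A :=
  match split i with
  | inl j => match split j with inl k => X`_k | inr k => Y`_k end
  | inr k => Z`_k
  end.

Lemma jet_ix (A : nzRingType) m (X Y Z : {poly A}) (k : 'I_m.+1) :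
  jet X Y Z (ix k) = X`_k.
Proof.
rewrite /jet /ix.
by rewrite -[lshift _ _]/(unsplit (inl _)) unsplitK
   -[lshift _ _]/(unsplit (inl _)) unsplitK.
Qed.

Lemma jet_iy (A : nzRingType) m (X Y Z : {poly A}) (k : 'I_m.+1) :
  jet X Y Z (iy k) = Y`_k.
Proof.
rewrite /jet /iy.
by rewrite -[lshift _ _]/(unsplit (inl _)) unsplitK
   -[rshift _ _]/(unsplit (inr _)) unsplitK.
Qed.

Lemma jet_iz (A : nzRingType) m (X Y Z : {poly A}) (k : 'I_m.+1) :
  jet X Y Z (iz k) = Z`_k.
Proof.
by rewrite /jet /iz -[rshift _ _]/(unsplit (inr _)) unsplitK.
Qed.

Lemma jet_ind (A : nzRingType) m (P : ('I_(jet_dim m) -> A) -> Prop) :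
  (forall X Y Z : {poly A}, P (jet X Y Z)) -> forall p, P p.
Proof.
move=> PJ p.
suff -> : p = jet (\poly_(k < m.+1) p (ix (inord k)))
  (\poly_(k < m.+1) p (iy (inord k))) (\poly_(k < m.+1) p (iz (inord k))) by [].
apply/funext => i; rewrite -(splitK i); case: (split i) => [j|k] /=.
  rewrite -(splitK j); case: (split j) => k /=.
    by rewrite -[lshift _ _]/(ix k) jet_ix coef_poly ltn_ord inord_val.
  by rewrite -[lshift _ _]/(iy k) jet_iy coef_poly ltn_ord inord_val.
by rewrite -[rshift _ _]/(iz k) jet_iz coef_poly ltn_ord inord_val.
Qed.

Lemma rmorph_jet (A B : nzRingType) m (phi : {rmorphism A -> B})
    (X Y Z : {poly A}) :
  phi \o jet X Y Z =1
  @jet B m (map_poly phi X) (map_poly phi Y) (map_poly phi Z).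
Proof.
move=> i; rewrite /jet /=.
by case: (split i) => [j|k]; first case: (split j) => k; rewrite coef_map.
Qed.

Lemma jet_trunc (A : nzRingType) m (X Y Z X' Y' Z' : {poly A}) :
  (forall k, (k <= m)%N -> X`_k = X'`_k) ->
  (forall k, (k <= m)%N -> Y`_k = Y'`_k) ->
  (forall k, (k <= m)%N -> Z`_k = Z'`_k) ->
  @jet A m X Y Z = jet X' Y' Z'.
Proof.
move=> eX eY eZ; apply/funext => i; rewrite /jet.
by case: (split i) => [j|k]; first case: (split j) => k;
  rewrite ?(eX, eY, eZ) // -ltnS ltn_ord.
Qed.

Lemma rmorph_fA n (A B : comNzRingType) (phi : {rmorphism A -> B}) (x y z : A) :
  phi (fA n x y z) = fA n (phi x) (phi y) (phi z).
Proof. by rewrite /fA rmorphB rmorphM rmorphXn. Qed.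

Section Field.
Variable K : fieldType.
Implicit Types X Y Z : {poly K}.

Lemma dvdXnP N (p : {poly K}) :
  reflect (forall i, (i < N)%N -> p`_i = 0) ('X^N %| p).
Proof.
apply: (iffP idP) => [/dvdpP [q ->] i iN|p0].
  by rewrite coefMXn iN.
rewrite -(poly_take_drop N p); have -> : take_poly N p = 0.
  by apply/polyP => i; rewrite coef_take_poly coef0; case: ifP => // /p0.
by rewrite add0r dvdp_mulIr.
Qed.

Lemma dvdXn_take N (p : {poly K}) : 'X^N %| take_poly N p - p.
Proof.
apply/dvdXnP => i iN; rewrite coefB coef_take_poly iN subrr //.
Qed.

Lemma dvdp_fA (d : {poly K}) n X Y Z X' Y' Z' :
  d %| X' - X -> d %| Y' - Y -> d %| Z' - Z ->
  d %| fA n X' Y' Z' - fA n X Y Z.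
Proof.
move=> dX dY dZ; rewrite /fA.
have -> : X' * Y' - Z' ^+ n.+1 - (X * Y - Z ^+ n.+1) =
    (X' - X) * Y' + X * (Y' - Y) - (Z' ^+ n.+1 - Z ^+ n.+1).
  by ring.
apply: dvdp_sub; last by rewrite subrXX dvdp_mulr.
by rewrite dvdp_add ?(dvdp_mulr _ dX) ?(dvdp_mull _ dY).
Qed.

Lemma meval_generic_arc m (c : 'I_m.+1 -> jet_ring K m) X v :
  (forall k, (c k).@[v] = X`_k) ->
  map_poly (meval v) (generic_arc c) = take_poly m.+1 X.
Proof.
move=> cX; rewrite /generic_arc rmorph_sum /take_poly poly_def.
apply: eq_bigr => k _.
by rewrite rmorphM /= map_polyC map_polyXn /= cX mul_polyC.
Qed.

(** The coefficients of f(X, Y, Z) up to t^m are determined by the truncations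
of X, Y, Z modulo t^(m+1), although X, Y, Z may have a higher degree. *)
Lemma meval_jet_f n m (k : 'I_m.+1) X Y Z :
  (jet_f K n k).@[jet X Y Z] = (fA n X Y Z)`_k.
Proof.
transitivity (fA n (take_poly m.+1 X) (take_poly m.+1 Y) (take_poly m.+1 Z))`_k.
  rewrite /jet_f -[LHS](coef_map (meval (jet X Y Z))) rmorph_fA.
  by congr (nth 0 (polyseq (fA n _ _ _)) _); apply: meval_generic_arc => i;
     rewrite mevalXU ?jet_ix ?jet_iy ?jet_iz.
apply/eqP; rewrite -subr_eq0 -coefB; apply/eqP.
have /dvdXnP := dvdp_fA n (dvdXn_take m.+1 X) (dvdXn_take m.+1 Y)
  (dvdXn_take m.+1 Z).
by apply.
Qed.

Lemma zero_locus_span N (G : set {mpoly K[N]}) p :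
  zero_locus (ideal_span G) p <-> forall g, G g -> g.@[p] = 0.
Proof.
split=> [Gp g Gg|Gp g].
  by apply: Gp => I [_]; apply.
move=> /(_ [set h | h.@[p] = 0]); apply.
split=> //; split=> [|a b a0 b0|c a a0] /=.
- by rewrite meval0.
- by rewrite mevalD a0 b0 addr0.
- by rewrite mevalM a0 mulr0.
Qed.

Lemma jet_f_vanish n m X Y Z :
  (forall g, range (@jet_f K n m) g -> g.@[jet X Y Z] = 0) <->
  'X^(m.+1) %| fA n X Y Z.
Proof.
split=> [f0|/dvdXnP f0 g [k _ <-]].
  apply/dvdXnP => i im; rewrite -[X in _`_X]/(nat_of_ord (Ordinal im)).
  rewrite -(meval_jet_f n (Ordinal im)).
  by apply: f0; exists (Ordinal im).
by rewrite meval_jet_f f0.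
Qed.

Lemma singular_fiberP n m X Y Z :
  singular_fiber K n m (jet X Y Z) <->
  [/\ 'X %| X, 'X %| Y, 'X %| Z & 'X^(m.+1) %| fA n X Y Z].
Proof.
have dX (p : {poly K}) : 'X %| p <-> p`_0 = 0.
  rewrite -['X]expr1; split=> [/dvdXnP/(_ 0%N) ->//|p0].
  by apply/dvdXnP => -[].
have dF : jet_scheme K n m (jet X Y Z) <-> 'X^(m.+1) %| fA n X Y Z.
  by rewrite -jet_f_vanish -zero_locus_span.
split=> [[/dF ?]|[/dX ? /dX ? /dX ? /dF ?]].
  rewrite /= /truncation jet_ix jet_iy jet_iz => -[? ? ?].
  by split=> //; apply/dX.
by split=> //; rewrite /= /truncation jet_ix jet_iy jet_iz; congr (_, _, _).
Qed.

Lemma Z_compP n m l X Y Z : (1 <= l <= n)%N -> (n <= m)%N ->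
  Z_comp K n m l (jet X Y Z) <->
  [/\ 'X^l %| X, 'X^((n - l).+1) %| Y, 'X %| Z & 'X^(m.+1) %| fA n X Y Z].
Proof.
move=> /andP[l0 ln] nm; rewrite /Z_comp /I_ideal zero_locus_span.
split=> [G0|[/dvdXnP X0 /dvdXnP Y0 Z0 /jet_f_vanish f0] g].
  split.
  - apply/dvdXnP => i il; have im : (i < m.+1)%N.
      by rewrite ltnS (leq_trans _ nm) // (leq_trans _ ln) // ltnW.
    rewrite -[X in _`_X]/(nat_of_ord (Ordinal im)) -(jet_ix X Y Z) -mevalXU.
    apply: G0.
    by left; left; left; exists (Ordinal im).
  - apply/dvdXnP => i il; have im : (i < m.+1)%N.
      by rewrite (leq_trans il) // ltnS (leq_trans _ nm) // leq_subr.
    rewrite -[X in _`_X]/(nat_of_ord (Ordinal im)) -(jet_iy X Y Z) -mevalXU.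
    apply: G0.
    by left; left; right; exists (Ordinal im).
  - rewrite -['X]expr1; apply/dvdXnP => -[] // _.
    rewrite -[X in _`_X]/(nat_of_ord (@ord0 m)) -(jet_iz X Y Z) -mevalXU.
    by apply: G0; left; right.
  - by apply/jet_f_vanish => g fg; apply: G0; right.
case=> [[[]|]|]; last exact: f0.
- by move=> [k /= kl <-]; rewrite mevalXU jet_ix X0.
- by move=> [k /= kl <-]; rewrite mevalXU jet_iy Y0.
- move=> ->; rewrite mevalXU jet_iz; move: Z0; rewrite -['X]expr1.
  by move=> /dvdXnP ->.
Qed.

End Field.

(** * Charts of the subvarieties *)

Definition scaled_jet (A : nzRingType) m a b (X Y Z : {poly A}) :=
  @jet A m ('X^a * X) ('X^b * Y) ('X * Z).
Arguments scaled_jet {A} m a b X Y Z.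

Lemma rmorph_scaled_jet (A B : nzRingType) m a b (phi : {rmorphism A -> B})
    (X Y Z : {poly A}) :
  phi \o scaled_jet m a b X Y Z =1
  scaled_jet m a b (map_poly phi X) (map_poly phi Y) (map_poly phi Z).
Proof. by move=> i; rewrite rmorph_jet !rmorphM /= !map_polyXn map_polyX. Qed.

Lemma fA_scaled (A : comNzRingType) n l (X Y Z : {poly A}) : (l <= n)%N ->
  fA n ('X^l * X) ('X^((n - l).+1) * Y) ('X * Z) = 'X^(n.+1) * fA n X Y Z.
Proof.
by move=> ln; rewrite /fA exprMn mulrBr mulrACA -exprD addnS subnKC.
Qed.

(** The exponents l, n - l + 1 and 1 are such that both terms of f acquire the
factor t^(n+1), so what remains are jets of lower order on the same surface
and some free coordinates. *)
Lemma Z_comp_scaledP (K : fieldType) n m l p : (1 <= l <= n)%N -> (n <= m)%N ->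
  Z_comp K n m l p <->
  exists X Y Z, 'X^(m - n) %| fA n X Y Z
             /\ p = scaled_jet m l (n - l).+1 X Y Z.
Proof.
move=> hl nm; have ln : (l <= n)%N by case/andP: hl.
have dvdE (F : {poly K}) : 'X^(m.+1) %| 'X^(n.+1) * F = ('X^(m - n) %| F).
  by rewrite -{1}(subnKC nm) -addSn exprD dvdp_mul2l // expf_neq0 // polyX_eq0.
split; last first.
  move=> [X' [Y' [Z' [F ->]]]].
  by rewrite /scaled_jet Z_compP // !dvdp_mulIl fA_scaled // dvdE; split.
elim/jet_ind: p => X Y Z; rewrite Z_compP //.
move=> [/dvdpP [X' ->] /dvdpP [Y' ->] /dvdpP [Z' ->]].
rewrite ![_ * 'X^_]mulrC [_ * 'X]mulrC fA_scaled // dvdE => F.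
by exists X', Y', Z'.
Qed.

(** When X(0) is nonzero this is the inverse of X modulo t^N, up to the scalar
X(0)^N: a truncated geometric series with its denominators cleared. *)
Definition scaled_inverse (A : nzRingType) N (X : {poly A}) : {poly A} :=
  \sum_(i < N) (X`_0)%:P ^+ (N.-1 - i) * ((X`_0)%:P - X) ^+ i.

(** On the locus where X(0) is nonzero, a solution of XY = Z^(n+1) modulo t^N is
Y = Z^(n+1) / X + t^N R. Substituting X(0)^N Z for Z removes the denominator
X(0)^N of 1 / X, since n + 1 >= 1, and the resulting formula is polynomial in
the coefficients of X, Z and R. *)
Definition chart_y (A : nzRingType) n N (X Z R : {poly A}) : {poly A} :=
  scaled_inverse N X * (X`_0)%:P ^+ N ^+ n * Z ^+ n.+1 + 'X^N * R.

Definition chart_z (A : nzRingType) N (X Z : {poly A}) : {poly A} :=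
  (X`_0)%:P ^+ N * Z.

Definition chart (A : nzRingType) m a b n N (X Z R : {poly A}) :=
  scaled_jet m a b X (chart_y n N X Z R) (chart_z N X Z).
Arguments chart {A} m a b n N X Z R.

Lemma rmorph_chart (A B : nzRingType) m a b n N (phi : {rmorphism A -> B})
    (X Z R : {poly A}) :
  phi \o chart m a b n N X Z R =1
  chart m a b n N (map_poly phi X) (map_poly phi Z) (map_poly phi R).
Proof.
move=> i; rewrite rmorph_scaled_jet /chart /chart_y /chart_z /scaled_inverse.
rewrite rmorphD !rmorphM !rmorphXn rmorph_sum /= map_polyC map_polyX coef_map.
congr (scaled_jet m a b _ (_ * _ * _ + _) _ i).
by apply: eq_bigr => j _; rewrite rmorphM !rmorphXn rmorphB /= map_polyC.
Qed.

Section Field.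
Variable K : fieldType.
Implicit Types X Y Z R : {poly K}.

Lemma scaled_inverseP N X : 'X^N %| X * scaled_inverse N X - (X`_0)%:P ^+ N.
Proof.
rewrite -dvdpNr opprB.
have -> : X * scaled_inverse N X = (X`_0)%:P ^+ N - ((X`_0)%:P - X) ^+ N.
  by rewrite subrXX opprB addrC subrK.
rewrite opprB addrC subrK dvdp_exp2r // -['X]expr1.
by apply/dvdXnP => -[|//] _; rewrite coefB coefC subrr.
Qed.

Lemma chart_fA n N X Z R : 'X^N %| fA n X (chart_y n N X Z R) (chart_z N X Z).
Proof.
set c := (X`_0)%:P ^+ N.
have -> : fA n X (chart_y n N X Z R) (chart_z N X Z) =
    (X * scaled_inverse N X - c) * (c ^+ n * Z ^+ n.+1) + 'X^N * (X * R).
  by rewrite /fA /chart_y /chart_z -/c exprMn (exprS c n); ring.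
by rewrite dvdp_add ?dvdp_mulIl // dvdp_mulr // scaled_inverseP.
Qed.

(** The hypothesis is on the power because for N = 0 there is no equation
and the chart is onto without any condition on X. *)
Lemma chart_onto n N X Y Z : X`_0 ^+ N != 0 -> 'X^N %| fA n X Y Z ->
  exists Z' R, Y = chart_y n N X Z' R /\ Z = chart_z N X Z'.
Proof.
set c := X`_0 ^+ N => c0 F.
have cE : (X`_0)%:P ^+ N = c%:P by rewrite polyC_exp.
pose Z' := c^-1 *: Z.
have ZE : Z = c%:P * Z' by rewrite mul_polyC scalerA mulfV // scale1r.
suff /dvdpP [R RE] : 'X^N %| Y - scaled_inverse N X * c%:P ^+ n * Z' ^+ n.+1.
  exists Z', R; rewrite /chart_y /chart_z cE; split=> //.
  by rewrite ['X^N * R]mulrC -RE addrC subrK.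
rewrite -(@dvdpZr _ c) // -mul_polyC.
have -> : c%:P * (Y - scaled_inverse N X * c%:P ^+ n * Z' ^+ n.+1) =
   - (X * scaled_inverse N X - c%:P) * Y + scaled_inverse N X * fA n X Y Z.
  by rewrite ZE /fA exprMn (exprS c%:P n); ring.
apply: dvdp_add; last exact: dvdp_mull.
by rewrite dvdp_mulr // dvdpNr -cE scaled_inverseP.
Qed.

End Field.

(** * Irreducibility *)

Section Density.
Variable K : numClosedFieldType.
Implicit Types X Y Z R : {poly K}.

Lemma monic_roots d X : X \is monic -> size X = d.+1 ->
  exists r : d.-tuple K, X = \prod_(a <- r) ('X - a%:P).
Proof.
move=> monX szX; have [r rE] := closed_field_poly_normal X.
rewrite (monicP monX) scale1r in rE.
have szr : size r == d by rewrite -eqSS -szX rE size_prod_XsubC.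
by exists (Tuple szr).
Qed.

Lemma map_take_poly (A B : nzRingType) (phi : {rmorphism A -> B}) k
    (p : {poly A}) :
  map_poly phi (take_poly k p) = take_poly k (map_poly phi p).
Proof.
apply/polyP => i; rewrite coef_map !coef_take_poly coef_map.
by case: ifP => // _; exact: rmorph0.
Qed.

Lemma map_polyCK s X : map_poly (horner_eval s) (X^:P) = X.
Proof.
by apply/polyP => i; rewrite !coef_map /= horner_evalE hornerC.
Qed.

(** Deform XY through polynomials P whose specializations at s do not vanish at
t = 0 for all but one s, and are (Z + s)^(n+1) modulo t^N. For these s, any
distribution of the 2d roots of the specialization into two halves gives a
jet with invertible X, and the given jet comes from one distribution at
s = 0. *)
Lemma monic_jet_dense m a b n N d (g : jet_ring K m) X Y Z :
  (0 < N <= d)%N ->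
  X \is monic -> Y \is monic -> size X = d.+1 -> size Y = d.+1 ->
  'X^N %| fA n X Y Z ->
  (forall X Y Z, X`_0 != 0 -> 'X^N %| fA n X Y Z ->
     g.@[scaled_jet m a b X Y Z] = 0) ->
  g.@[scaled_jet m a b X Y Z] = 0.
Proof.
move=> /andP[N0 Nd] monX monY szX szY F g0.
pose Zs := Z^:P + ('X)%:P : {poly {poly K}}.
pose Q := take_poly N (Zs ^+ n.+1 - Z^:P ^+ n.+1).
pose P := (X * Y)^:P + Q.
have szXY : size (X * Y) = (d + d).+1.
  by rewrite size_monicM ?monic_neq0 // szX szY addnS.
have szQ : (size Q < size (X * Y)^:P)%N.
  rewrite size_map_polyC szXY ltnS (leq_trans (size_take_poly _ _)) //.
  by rewrite (leq_trans Nd) // leq_addr.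
have szP : size P = (d + d).+1 by rewrite /P size_polyDl // size_map_polyC.
have monP : P \is monic.
  by rewrite monicE /P lead_coefDl // -monicE map_monic monicMr.
(* X, Y and Z over the ring in the 2d roots and s, so that G is the value of g
   as a function of these *)
pose Xg := \prod_(i < d) ('X - ('X_(lshift d i))%:P) :
  {poly {mpoly {poly K}[d + d]}}.
pose Yg := \prod_(i < d) ('X - ('X_(rshift d i))%:P) :
  {poly {mpoly {poly K}[d + d]}}.
pose Zg := map_poly (@mpolyC (d + d) {poly K}) Zs.
pose G :=
  mmap (@mpolyC (d + d) {poly K} \o polyC) (scaled_jet m a b Xg Yg Zg) g.
have ZsE s : map_poly (horner_eval s) Zs = Z + s%:P.
  by rewrite rmorphD /= map_polyCK map_polyC /= horner_evalE hornerX.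
have GE s (al : (d + d).-tuple K) : mmap (horner_eval s) (tnth al) G =
    g.@[scaled_jet m a b (\prod_(i < d) ('X - (tnth al (lshift d i))%:P))
         (\prod_(i < d) ('X - (tnth al (rshift d i))%:P)) (Z + s%:P)].
  rewrite /G rmorph_mmap /meval; apply: eq_mmap => [x|i] /=.
    by rewrite mmapC; exact: hornerC.
  rewrite -[LHS]/((mmap (horner_eval s) (tnth al) \o _) i) rmorph_scaled_jet.
  congr (scaled_jet m a b _ _ _ i); last first.
  - rewrite -ZsE -map_poly_comp; apply: eq_map_poly => q.
    by rewrite /= mmapC.
  - rewrite rmorph_prod; apply: eq_bigr => j _.
    by rewrite rmorphB /= map_polyX map_polyC /= mmapX mmap1U.
  - rewrite rmorph_prod; apply: eq_bigr => j _.
    by rewrite rmorphB /= map_polyX map_polyC /= mmapX mmap1U.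
have [rX XE] := monic_roots monX szX.
have [rY YE] := monic_roots monY szY.
have prodE (al : (d + d).-tuple K) : \prod_(c <- al) ('X - c%:P) =
    \prod_(i < d) ('X - (tnth al (lshift d i))%:P) *
    \prod_(i < d) ('X - (tnth al (rshift d i))%:P).
  by rewrite big_tuple big_split_ord.
have cE : mmap (horner_eval 0) (tnth (cat_tuple rX rY)) G =
    g.@[scaled_jet m a b X Y Z].
  rewrite GE addr0; congr (g.@[scaled_jet m a b _ _ _]).
    by rewrite XE big_tuple; apply: eq_bigr => i _; rewrite tnth_lshift.
  by rewrite YE big_tuple; apply: eq_bigr => i _; rewrite tnth_rshift.
rewrite -cE.
apply: (vanishing_on_roots_specializes (P := P) (c := - Z`_0)) => //;
  last first.
  rewrite big_cat -XE -YE rmorphD /= map_polyCK map_take_poly rmorphB /=.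
  by rewrite !rmorphXn /= ZsE map_polyCK addr0 subrr /= take_poly0r addr0.
(* the only excluded value of s is the one where Z + s vanishes at t = 0 *)
move=> s al ns rootP; rewrite GE; set X' := \prod_(i < d) _.
set Y' := \prod_(i < d) _.
have F' : 'X^N %| fA n X' Y' (Z + s%:P).
  rewrite /fA -prodE rootP rmorphD /= map_polyCK map_take_poly rmorphB /=.
  rewrite !rmorphXn /= ZsE map_polyCK.
  set W := _ - Z ^+ _.
  have -> : X * Y + take_poly N W - (Z + s%:P) ^+ n.+1 =
    fA n X Y Z + (take_poly N W - W) by rewrite /W /fA; ring.
  by rewrite dvdp_add // dvdXn_take.
apply: g0 => //; apply: contra_neq ns => X0.
have /dvdXnP/(_ 0%N N0)/eqP := F'.
rewrite coefB coef0M X0 mul0r sub0r oppr_eq0 -horner_coef0.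
rewrite horner_exp hornerD hornerC horner_coef0 expf_eq0 addrC addr_eq0.
by move=> /eqP.
Qed.

(** Truncating X and Y at degree d > m and adding t^d makes them monic without
changing the jet, and as d >= N it does not change the congruence either. *)
Lemma chart_jet_dense m a b n N (g : jet_ring K m) X Y Z :
  'X^N %| fA n X Y Z ->
  (forall X Z R, g.@[chart m a b n N X Z R] = 0) ->
  g.@[scaled_jet m a b X Y Z] = 0.
Proof.
move=> F g0.
have g_unit X' Y' Z' : X'`_0 ^+ N != 0 -> 'X^N %| fA n X' Y' Z' ->
    g.@[scaled_jet m a b X' Y' Z'] = 0.
  move=> X0 /(chart_onto X0) [Z1 [R [-> ->]]]; exact: g0.
have [N0|Npos] := posnP N; first by apply: g_unit => //; rewrite N0 oner_neq0.
pose d := maxn m.+1 N.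
pose lift_monic (p : {poly K}) := take_poly d p + 'X^d.
have lift_coef p i : (i < d)%N -> (lift_monic p)`_i = p`_i.
  by move=> id; rewrite coefD coef_take_poly coefXn id (ltn_eqF id) addr0.
have szlt (p : {poly K}) : (size (take_poly d p) < size ('X^d : {poly K}))%N.
  by rewrite size_polyXn ltnS size_take_poly.
have lift_size p : size (lift_monic p) = d.+1.
  by rewrite /lift_monic addrC (size_polyDl (szlt p)) size_polyXn.
have lift_mon p : lift_monic p \is monic.
  by rewrite monicE /lift_monic addrC (lead_coefDl (szlt p)) lead_coefXn.
have lift_dvd p : 'X^N %| lift_monic p - p.
  apply/dvdXnP => i iN; rewrite coefB lift_coef ?subrr //.
  by rewrite (leq_trans iN) // leq_maxr.
have -> : scaled_jet m a b X Y Z =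
    scaled_jet m a b (lift_monic X) (lift_monic Y) Z.
  apply: jet_trunc => // k km; rewrite !coefXnM; case: ifP => // _;
  by rewrite lift_coef // /d (leq_ltn_trans (leq_subr _ _)) // leq_max ltnS km.
apply: (@monic_jet_dense _ _ _ n N d) => //.
- by rewrite Npos leq_maxr.
- rewrite -(subrK (fA n X Y Z) (fA n _ _ _)) dvdp_add // dvdp_fA //.
  by rewrite subrr dvdp0.
move=> X' Y' Z' X0; apply: g_unit; exact: expf_neq0.
Qed.

(** On the line joining two parameter values the functions become polynomials in
one variable, and a product of two nonzero polynomials has a nonzero value. *)
Lemma charts_meet m a b n N (g h : jet_ring K m) X1 Z1 R1 X2 Z2 R2 :
  g.@[chart m a b n N X1 Z1 R1] != 0 -> h.@[chart m a b n N X2 Z2 R2] != 0 ->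
  exists X Z R, g.@[chart m a b n N X Z R] != 0
             /\ h.@[chart m a b n N X Z R] != 0.
Proof.
move=> g1 h2.
pose ln p q : {poly {poly K}} := p^:P + ('X)%:P * (q - p)^:P.
have lnE p q s : map_poly (horner_eval s) (ln p q) = p + s%:P * (q - p).
  rewrite rmorphD rmorphM /= !map_polyCK map_polyC /=.
  by rewrite horner_evalE hornerX.
pose on_line (k : jet_ring K m) :=
  mmap (@polyC K) (chart m a b n N (ln X1 X2) (ln Z1 Z2) (ln R1 R2)) k.
have on_lineE k s : (on_line k).[s] = k.@[chart m a b n N
    (X1 + s%:P * (X2 - X1)) (Z1 + s%:P * (Z2 - Z1)) (R1 + s%:P * (R2 - R1))].
  rewrite -horner_evalE /on_line rmorph_mmap; apply: eq_mmap => [x|i].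
    exact: hornerC.
  by rewrite rmorph_chart !lnE.
have G0 : on_line g != 0.
  apply: contra_neq g1 => G0; have := on_lineE g 0.
  by rewrite G0 horner0 !mul0r !addr0.
have H0 : on_line h != 0.
  apply: contra_neq h2 => H0; have := on_lineE h 1.
  by rewrite H0 horner0 !mul1r ![_ + (_ - _)]addrC !subrK.
have [[s]|no_s] := pselect (exists s, (on_line g * on_line h).[s] != 0).
  by rewrite hornerM mulf_eq0 negb_or !on_lineE => /andP[gs hs]; do 3!eexists;
     split; [exact: gs|exact: hs].
have : on_line g * on_line h = 0.
  apply: (@poly_eq0_cofinite _ _ 0) => s _; apply/eqP.
  by apply: contrapT => /negP s0; apply: no_s; exists s.
by move=> /eqP; rewrite mulf_eq0 (negPf G0) (negPf H0).
Qed.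

Lemma zero_locusN N (Z : set (affine_space K N)) A : zariski_closed A ->
  ~ Z `<=` A -> exists g : {mpoly K[N]}, (forall p, A p -> g.@[p] = 0) /\
    exists2 p, Z p & g.@[p] != 0.
Proof.
move=> [I ->] /nonsubset [p [Zp /existsNP [g /not_implyP [Ig /eqP gp]]]].
by exists g; split; [move=> q; apply | exists p].
Qed.

Lemma Z_comp_irreducible n m l : (1 <= l <= n)%N -> (n <= m)%N ->
  zariski_irreducible (Z_comp K n m l).
Proof.
move=> hl nm.
pose C := @chart K m l (n - l).+1 n (m - n).
have C_in X Z R : Z_comp K n m l (C X Z R).
  apply/Z_comp_scaledP => //; do 3!eexists; split; last by [].
  exact: chart_fA.
have C_dense g : (exists2 p, Z_comp K n m l p & g.@[p] != 0) ->
    exists X Z R, g.@[C X Z R] != 0.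
  move=> [p /Z_comp_scaledP [] // X [Y [Z [F ->]]] gp].
  apply: contrapT => noC; move/eqP: gp; apply; apply: (chart_jet_dense F).
  move=> X' Z' R'; apply/eqP; apply: contrapT => /negP gC; apply: noC.
  by exists X', Z', R'.
split; first by exists (C 0 0 0).
move=> A B clA clB ZAB; apply: contrapT => /not_orP [].
move=> /(zero_locusN clA) [g [gA /C_dense [X1 [Z1 [R1 g1]]]]].
move=> /(zero_locusN clB) [h [hB /C_dense [X2 [Z2 [R2 h2]]]]].
have [X [Z [R [gC hC]]]] := charts_meet g1 h2.
by case: (ZAB _ (C_in X Z R)) => [/gA|/hB] /eqP; apply/negP.
Qed.

End Density.

(** * Components and their intersections *)

Section Components.
Variables (K : fieldType) (N : nat).
Implicit Types A B W : set (affine_space K N).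

Lemma zariski_closedU A B :
  zariski_closed A -> zariski_closed B -> zariski_closed (A `|` B).
Proof.
move=> [I ->] [J ->].
exists [set f | exists g h, [/\ I g, J h & f = g * h]].
apply/seteqP; split=> [p [Ip|Jp] _ [g [h [Ig Jh ->]]]|p IJp].
- by rewrite mevalM (Ip g Ig) mul0r.
- by rewrite mevalM (Jp h Jh) mulr0.
apply: contrapT => /not_orP [/existsNP [g /not_implyP [Ig gp]]].
move=> /existsNP [h /not_implyP [Jh hp]].
have : (g * h).@[p] = 0 by apply: IJp; exists g, h.
by rewrite mevalM => /eqP; rewrite mulf_eq0 => /orP[/eqP|/eqP].
Qed.

Lemma zariski_closed0 : zariski_closed (set0 : set (affine_space K N)).
Proof.
exists [set 1]; apply/seteqP; split=> // p /(_ 1 erefl) /eqP.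
by rewrite meval1 oner_eq0.
Qed.

Lemma irreducible_in_union (F : nat -> set (affine_space K N)) n W :
  (forall i, zariski_closed (F i)) -> zariski_irreducible W ->
  W `<=` \bigcup_(i < n) F i -> exists2 i, (i < n)%N & W `<=` F i.
Proof.
move=> clF [[p Wp] irrW].
have clU k : zariski_closed (\bigcup_(i < k) F i).
  elim: k => [|k IH].
    by rewrite bigcup_mkord big_ord0; apply: zariski_closed0.
  rewrite bigcup_mkord big_ord_recr /= -bigcup_mkord; exact: zariski_closedU.
elim: n => [|n IH] WF; first by case: (WF p Wp).
move: WF; rewrite bigcup_mkord big_ord_recr /= -bigcup_mkord.
move=> /(irrW _ _ (clU n) (clF n)) [/IH [i im Wi]|Wn]; last by exists n.
by exists i => //; apply: leqW.
Qed.

End Components.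

Lemma factor_X_power (K : fieldType) n (X : {poly K}) :
  exists l X', [/\ (l <= n)%N, X = 'X^l * X' & l = n \/ X'`_0 != 0].
Proof.
elim: n => [|n [l [X' [ln XE lX']]]].
  by exists 0%N, X; split; rewrite ?mul1r //; left.
have [X0|X0] := eqVneq X'`_0 0; last first.
  by exists l, X'; split; [exact: leqW | | right].
case: lX' => [lE|]; last by rewrite X0 eqxx.
have /dvdpP [X'' X'E] : 'X^1 %| X' by apply/dvdXnP => -[].
exists l.+1, X''; split; [by rewrite ltnS| |by left; rewrite lE].
by rewrite XE X'E mulrC -mulrA -exprD mulrC.
Qed.

Section JetComponents.
Variables (K : numClosedFieldType) (n m : nat).
Hypotheses (n0 : (1 <= n)%N) (nm : (n <= m)%N).
Local Notation Zc := (Z_comp K n m).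

Lemma dvdXX k l : ('X^k %| ('X^l : {poly K})) = (k <= l)%N.
Proof. by rewrite dvdp_Pexp2l // size_polyX. Qed.

(** Take for l the order of X, capped at n. If l < n, then X / t^l is prime to
t, so the divisibility of XY by t^(n+1) passes to Y. If l = n, then Y need only
be divisible by t. *)
Lemma singular_fiber_cover p :
  singular_fiber K n m p <-> exists2 l, (1 <= l <= n)%N & Zc l p.
Proof.
elim/jet_ind: p => X Y Z; rewrite singular_fiberP; split; last first.
  move=> [l hl]; rewrite Z_compP // => -[Xl Yl Z1 F]; split=> //.
    by apply: dvdp_trans Xl; apply: dvdp_exp => //; case/andP: hl.
  by apply: dvdp_trans Yl; apply: dvdp_exp.
move=> [X1 Y1 Z1 F].
have [l [X' [ln XE lX']]] := factor_X_power n X.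
have l0 : (0 < l)%N.
  case: posnP => // l0; case: lX' => [ln0|/eqP []].
    by move: n0; rewrite -ln0 l0.
  by move: X1; rewrite XE l0 mul1r -['X]expr1 => /dvdXnP ->.
exists l; first by rewrite l0 ln.
apply/Z_compP; rewrite ?l0 ?ln //; split=> //; first by rewrite XE dvdp_mulIl.
case: lX' => [->|X'0]; first by rewrite subnn.
have XYn : 'X^(n.+1) %| X * Y.
  have -> : X * Y = fA n X Y Z + Z ^+ n.+1 by rewrite subrK.
  rewrite dvdp_add ?dvdp_exp2r //.
  by apply: dvdp_trans F; rewrite dvdXX.
have copX' : coprimep ('X^((n - l).+1)) X'.
  by rewrite coprimep_sym coprimep_expr // coprimepX /root horner_coef0.
rewrite -(Gauss_dvdpr _ copX').
rewrite -(@dvdp_mul2l _ ('X^l)) ?expf_neq0 ?polyX_eq0 //.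
by rewrite -exprD addnS subnKC // mulrA -XE.
Qed.

(** The arc (t^i, t^(n-i+1), t) has the smallest possible orders on the i-th
subvariety. *)
Lemma Z_comp_subset_eq i j : (1 <= i <= n)%N -> (1 <= j <= n)%N ->
  Zc i `<=` Zc j -> i = j.
Proof.
move=> hi hj; move=> /(_ (jet 'X^i 'X^((n - i).+1) 'X)).
have /andP[i0 ni] := hi; have /andP[j0 nj] := hj.
rewrite !Z_compP // !dvdXX !dvdpp => -[].
  split=> //; have := fA_scaled (1 : {poly K}) 1 1 ni; rewrite !mulr1 => ->.
  by rewrite /fA mulr1 expr1n subrr mulr0 dvdp0.
rewrite ltnS => ji nij _ _; apply/eqP; rewrite eqn_leq ji andbT.
by rewrite -(leq_sub2lE _ ni).
Qed.

(** The jets (t^j, 0, 0) and (0, t^(n-i+1), 0) detect the two ends of the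
interval. Both satisfy the equation, since Z and one of X, Y are zero. *)
Lemma Z_compI_sub i j k l :
  (1 <= i < j)%N -> (j <= n)%N -> (1 <= k < l)%N -> (l <= n)%N ->
  Zc i `&` Zc j `<=` Zc k `&` Zc l <-> (i <= k)%N && (l <= j)%N.
Proof.
move=> /andP[i0 ij] jn /andP[k0 kl] ln.
have hi : (1 <= i <= n)%N by rewrite i0 (leq_trans _ jn) // ltnW.
have hk : (1 <= k <= n)%N by rewrite k0 (leq_trans _ ln) // ltnW.
have hj : (1 <= j <= n)%N by rewrite jn andbT (leq_trans i0) // ltnW.
have hl : (1 <= l <= n)%N by rewrite ln andbT (leq_trans k0) // ltnW.
split=> [sub|/andP[ik lj]].
  have fX : 'X^(m.+1) %| fA n ('X^j : {poly K}) 0 0.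
    by rewrite /fA mulr0 expr0n subrr dvdp0.
  have fY : 'X^(m.+1) %| fA n (0 : {poly K}) 'X^((n - i).+1) 0.
    by rewrite /fA mul0r expr0n subrr dvdp0.
  apply/andP; split.
    have [] : (Zc k `&` Zc l) (jet 0 'X^((n - i).+1) 0).
      have nji : (n - j <= n - i)%N by rewrite leq_sub2l // ltnW.
      by apply: sub; split; apply/Z_compP => //; split;
         rewrite ?dvdp0 ?dvdXX ?ltnS.
    move=> /Z_compP [] // _; rewrite dvdXX ltnS => + _ _ _.
    by rewrite leq_sub2lE //; case/andP: hi.
  have [_] : (Zc k `&` Zc l) (jet 'X^j 0 0).
    have ij' := ltnW ij.
    by apply: sub; split; apply/Z_compP => //; split; rewrite ?dvdp0 ?dvdXX.
  by move=> /Z_compP [] //; rewrite dvdXX.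
elim/jet_ind => X Y Z [/Z_compP [] // Xi Yi Z1 F /Z_compP [] // Xj Yj _ _].
split; apply/Z_compP => //; split=> //.
- by apply: dvdp_trans Xj; rewrite dvdXX (leq_trans _ lj) // ltnW.
- by apply: dvdp_trans Yi; rewrite dvdXX ltnS leq_sub2l.
- by apply: dvdp_trans Xj; rewrite dvdXX.
- apply: dvdp_trans Yi; rewrite dvdXX ltnS leq_sub2l //.
  by rewrite (leq_trans ik) // ltnW.
Qed.

(** An irreducible subset of the fiber lies in one of the finitely many closed
sets that cover it, and none of these is contained in another. *)
Lemma jet_componentsE :
  jet_components K n m = Zc @` [set l | (1 <= l <= n)%N].
Proof.
have in_some W : zariski_irreducible W -> W `<=` singular_fiber K n m ->
    exists2 l, (1 <= l <= n)%N & W `<=` Zc l.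
  move=> irrW WF.
  have [] := @irreducible_in_union _ _ (fun i => Zc i.+1) n W.
  - by move=> i; exists (I_ideal K n m i.+1).
  - by [].
  - by move=> p /WF /singular_fiber_cover [[|l] // hl pl]; exists l.
  - by move=> l ln Wl; exists l.+1.
have Z_in l : (1 <= l <= n)%N -> Zc l `<=` singular_fiber K n m.
  by move=> hl p pl; apply/singular_fiber_cover; exists l.
apply/seteqP; split=> [Z [irrZ ZF maxZ]|_ [l /= hl <-]].
  have [l hl Zl] := in_some Z irrZ ZF.
  exists l => //; apply: maxZ => //; [exact: Z_comp_irreducible | exact: Z_in].
split; [exact: Z_comp_irreducible | exact: Z_in | move=> W irrW WF lW].
have [k hk Wk] := in_some W irrW WF.
have lk : l = k by apply: Z_comp_subset_eq => //; apply: subset_trans lW Wk.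
by rewrite -lk in Wk; apply/seteqP.
Qed.

Lemma component_intersectionsP A :
  component_intersections K n m A <->
  exists i j, [/\ (1 <= i < j)%N, (j <= n)%N & A = Zc i `&` Zc j].
Proof.
rewrite /component_intersections jet_componentsE; split.
  move=> [_ [_ [[i /= hi <-] [j /= hj <-] ij ->]]].
  have /andP[i0 ni] := hi; have /andP[j0 nj] := hj.
  case: (ltngtP i j) => [lt_ij|lt_ji|eij].
  - by exists i, j; rewrite i0.
  - by exists j, i; rewrite j0 setIC.
  - by rewrite eij in ij.
move=> [i [j [/andP[i0 ij] nj ->]]].
have hi : (1 <= i <= n)%N by rewrite i0 (leq_trans _ nj) // ltnW.
have hj : (1 <= j <= n)%N by rewrite nj (leq_trans _ ij).
exists (Zc i), (Zc j); split=> // Zij.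
have eij : i = j by apply: Z_comp_subset_eq => //; rewrite Zij.
by rewrite eij ltnn in ij.
Qed.

(** The intervals of length one are the minimal ones, and each interval [i, j]
contains [i, i + 1]. *)
Lemma maximal_Z_compI i j : (1 <= i < j)%N -> (j <= n)%N ->
  maximal_elements (component_intersections K n m) (Zc i `&` Zc j) <->
  i.+1 = j.
Proof.
move=> ij jn; split=> [[_ maxij]|ij1].
  have /andP[i0 lt_ij] := ij.
  have i1 : (1 <= i < i.+1)%N by rewrite i0 leqnn.
  have i1n : (i.+1 <= n)%N by apply: leq_trans jn.
  have le : Zc i `&` Zc j `<=` Zc i `&` Zc i.+1.
    by apply/(Z_compI_sub ij jn i1 i1n); rewrite leqnn.
  have E : Zc i `&` Zc i.+1 = Zc i `&` Zc j.
    by apply: maxij => //; apply/component_intersectionsP; exists i, i.+1.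
  have /(Z_compI_sub i1 i1n ij jn) :
      Zc i `&` Zc i.+1 `<=` Zc i `&` Zc j by rewrite E.
  rewrite leqnn /= => ji; apply/eqP.
  by rewrite eqn_leq lt_ij ji.
split; first by apply/component_intersectionsP; exists i, j.
move=> _ /component_intersectionsP [k [l [kl ln ->]]] sub.
have /andP[ik lj] := (Z_compI_sub ij jn kl ln).1 sub.
apply/seteqP; split=> //; apply/(Z_compI_sub kl ln ij jn).
move: lj; rewrite -ij1 => li.
have /andP[_ lt_kl] := kl.
have ki : (k <= i)%N by rewrite -ltnS (leq_trans lt_kl).
by rewrite ki (leq_ltn_trans ik).
Qed.

Lemma jet_edgeP (u v : jet_graph K n m) i j :
  (1 <= i <= n)%N -> (1 <= j <= n)%N -> \val u = Zc i -> \val v = Zc j ->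
  edge u v <-> (i.+1 = j \/ j.+1 = i).
Proof.
move=> hi hj uE vE; rewrite /= /jet_edge uE vE.
have /andP[i0 ni] := hi; have /andP[j0 nj] := hj.
have uv : i <> j -> u <> v.
  by move=> ij uv; apply: ij; apply: Z_comp_subset_eq => //; rewrite -uE uv vE.
case: (ltngtP i j) => [ij|ji|ij].
- rewrite maximal_Z_compI ?i0 //; split=> [[_ ->]|[ij1|ji]]; [by left| |].
    by split=> //; apply: uv => eij; rewrite eij ltnn in ij.
  by move: ij; rewrite -ji ltnNge leqnSn.
- rewrite setIC maximal_Z_compI ?j0 //.
  split=> [[_ ->]|[ij|ji1]]; [by right| |].
    by move: ji; rewrite -ij ltnNge leqnSn.
  by split=> //; apply: uv => eij; rewrite eij ltnn in ji.
- split=> [[ne _]|[E|E]].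
  + by case: ne; apply: val_inj; rewrite uE vE ij.
  + by move/eqP: E; rewrite ij gtn_eqF.
  + by move/eqP: E; rewrite ij gtn_eqF.
Qed.

Lemma jet_graph_iso :
  graph_isomorphic (jet_graph K n m) (resolution_graph_A n).
Proof.
have rng (i : 'I_n) : (1 <= i.+1 <= n)%N by rewrite ltn_ord.
have exi (u : jet_graph K n m) : exists i : 'I_n, \val u = Zc i.+1.
  have : jet_components K n m (\val u) by apply: set_valP.
  move: (\val u) => W; rewrite jet_componentsE => -[[|l] //= ln <-].
  by exists (Ordinal ln).
have [f fE] := choice exi.
have compZ (i : 'I_n) : Zc i.+1 \in jet_components K n m.
  by rewrite inE jet_componentsE; exists i.+1 => //=; exact: rng.
pose g (i : 'I_n) : jet_graph K n m := exist _ (Zc i.+1) (compZ i).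
exists f; split.
  exists g => [u|i]; first by apply: val_inj; rewrite /= fE.
  have E : Zc i.+1 = Zc (f (g i)).+1 by rewrite -fE.
  apply: val_inj; apply: succn_inj; apply: Z_comp_subset_eq; [exact: rng..|].
  by rewrite -E.
move=> u v; rewrite (jet_edgeP (rng _) (rng _) (fE u) (fE v)) /= /path_edge.
by split=> [[[E]|[E]]|[E|E]]; [left|right|left; rewrite E|right; rewrite E].
Qed.

End JetComponents.

Theorem corollary2p16 (R : realType) (n m : nat)
    (hn : (1 <= n)%N) (hm : (n <= m)%N) :
  jet_components R[i] n m = Z_comp R[i] n m @` [set l | (1 <= l <= n)%N]
  /\ graph_isomorphic (jet_graph R[i] n m) (resolution_graph_A n).
Proof. by split; [exact: jet_componentsE | exact: jet_graph_iso]. Qed.
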